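(* Let $F_A$ and $G_A$ be two interval-valued hesitant fuzzy soft sets over $(U,E)$ with the same nonempty parameter set $A\subseteq E$. Then: (i) $(F_A\tilde{\cup}G_A)^C=F_A^C\,\tilde{\cap}\,G_A^C$; (ii) $(F_A\tilde{\cap}G_A)^C=F_A^C\,\tilde{\cup}\,G_A^C$.
   Context: $U$ is an initial universe and $E$ a set of parameters. An interval-valued hesitant fuzzy element (IVHFE) is a nonempty set of closed intervals $\gamma=[\gamma^L,\gamma^U]\subseteq[0,1]$. For IVHFEs $\mu,\mu_1,\mu_2$: $\mu^C=\{[1-\gamma^U,1-\gamma^L]:\gamma\in\mu\}$, $\mu_1\cup\mu_2=\{[\max(\gamma_1^L,\gamma_2^L),\max(\gamma_1^U,\gamma_2^U)]:\gamma_1\in\mu_1,\gamma_2\in\mu_2\}$ and $\mu_1\cap\mu_2=\{[\min(\gamma_1^L,\gamma_2^L),\min(\gamma_1^U,\gamma_2^U)]:\gamma_1\in\mu_1,\gamma_2\in\mu_2\}$. An interval-valued hesitant fuzzy soft set $F_A$ over $(U,E)$, with $A\subseteq E$, assigns to each $e\in A$ and each $h\in U$ an IVHFE $\mu_{F(e)}(h)$. Two such sets are equal when they have the same parameter set and the same IVHFE for every $e$ and $h$. The complement $F_A^C$ has parameter set $A$ and values $(\mu_{F(e)}(h))^C$. For two interval-valued hesitant fuzzy soft sets with the same parameter set $A$, $F_A\tilde\cup G_A$ and $F_A\tilde\cap G_A$ have parameter set $A$ and values $\mu_{F(e)}(h)\cup\mu_{G(e)}(h)$ and $\mu_{F(e)}(h)\cap\mu_{G(e)}(h)$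 respectively, for all $e\in A$, $h\in U$. *)

(* Defs.v *)
From mathcomp Require Import all_boot all_order all_algebra.
From mathcomp Require Import boolp classical_sets reals.
Set Implicit Arguments.
Unset Strict Implicit.
Unset Printing Implicit Defensive.
Import Order.TTheory GRing.Theory Num.Theory.
Local Open Scope classical_set_scope.
Local Open Scope ring_scope.

(* A nonempty closed interval [itv_lo, itv_hi] contained in [0, 1]; it is
   determined by its endpoints, so Leibniz equality is equality of intervals. *)
Record subitv01 (R : realType) := SubItv01 {
  itv_lo : R;
  itv_hi : R;
  subitv01P : [&& 0 <= itv_lo, itv_lo <= itv_hi & itv_hi <= 1] }.

Lemma subitv01_compl_subproof (R : realType) (g : subitv01 R) :
  [&& 0 <= 1 - itv_hi g, 1 - itv_hi g <= 1 - itv_lo g & 1 - itv_lo g <= 1].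
Proof.
case: g => l u /= /and3P[l0 lu u1].
by rewrite subr_ge0 u1 lerB //= lerBlDr lerDl.
Qed.

Definition subitv01_compl (R : realType) (g : subitv01 R) : subitv01 R :=
  SubItv01 (subitv01_compl_subproof g).

Lemma subitv01_max_subproof (R : realType) (g1 g2 : subitv01 R) :
  [&& 0 <= Num.max (itv_lo g1) (itv_lo g2),
      Num.max (itv_lo g1) (itv_lo g2) <= Num.max (itv_hi g1) (itv_hi g2)
    & Num.max (itv_hi g1) (itv_hi g2) <= 1].
Proof.
case: g1 g2 => [l1 u1 /= /and3P[l10 lu1 u11]] [l2 u2 /= /and3P[l20 lu2 u21]].
by rewrite le_max l10 /= !ge_max !le_max lu1 lu2 u11 u21 orbT.
Qed.

Definition subitv01_max (R : realType) (g1 g2 : subitv01 R) : subitv01 R :=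
  SubItv01 (subitv01_max_subproof g1 g2).

Lemma subitv01_min_subproof (R : realType) (g1 g2 : subitv01 R) :
  [&& 0 <= Num.min (itv_lo g1) (itv_lo g2),
      Num.min (itv_lo g1) (itv_lo g2) <= Num.min (itv_hi g1) (itv_hi g2)
    & Num.min (itv_hi g1) (itv_hi g2) <= 1].
Proof.
case: g1 g2 => [l1 u1 /= /and3P[l10 lu1 u11]] [l2 u2 /= /and3P[l20 lu2 u21]].
by rewrite le_min l10 l20 /= le_min !ge_min lu1 lu2 u11 orbT.
Qed.

Definition subitv01_min (R : realType) (g1 g2 : subitv01 R) : subitv01 R :=
  SubItv01 (subitv01_min_subproof g1 g2).

(* ivhfe = interval-valued hesitant fuzzy element; the set may be infinite. *)
Record ivhfe (R : realType) := IVHFE {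
  ivhfe_set :> set (subitv01 R);
  ivhfe_neq0 : ivhfe_set !=set0 }.

Lemma ivhfe_compl_subproof (R : realType) (mu : ivhfe R) :
  [set subitv01_compl g | g in (mu : set (subitv01 R))] !=set0.
Proof. by case: mu => mu [g mug]; exists (subitv01_compl g), g. Qed.

Definition ivhfe_compl (R : realType) (mu : ivhfe R) : ivhfe R :=
  IVHFE (ivhfe_compl_subproof mu).

Lemma ivhfe_union_subproof (R : realType) (mu1 mu2 : ivhfe R) :
  [set subitv01_max g1 g2 | g1 in (mu1 : set (subitv01 R))
                          & g2 in (mu2 : set (subitv01 R))] !=set0.
Proof.
case: mu1 mu2 => [mu1 [g1 m1]] [mu2 [g2 m2]].
by exists (subitv01_max g1 g2), g1 => //; exists g2.
Qed.

Definition ivhfe_union (R : realType) (mu1 mu2 : ivhfe R) : ivhfe R :=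
  IVHFE (ivhfe_union_subproof mu1 mu2).

Lemma ivhfe_inter_subproof (R : realType) (mu1 mu2 : ivhfe R) :
  [set subitv01_min g1 g2 | g1 in (mu1 : set (subitv01 R))
                          & g2 in (mu2 : set (subitv01 R))] !=set0.
Proof.
case: mu1 mu2 => [mu1 [g1 m1]] [mu2 [g2 m2]].
by exists (subitv01_min g1 g2), g1 => //; exists g2.
Qed.

Definition ivhfe_inter (R : realType) (mu1 mu2 : ivhfe R) : ivhfe R :=
  IVHFE (ivhfe_inter_subproof mu1 mu2).

(* ivhfss = interval-valued hesitant fuzzy soft set over (U, E) with parameter set A:
   F e h is the value for the parameter e (an element of A) at h.  The
   parameter set is an index of the type, and by functional extensionality
   Leibniz equality is equality of the values for every e in A and h in U. *)
Definition ivhfss (R : realType) (U E : Type) (A : set E) : Type :=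
  set_type A -> U -> ivhfe R.

Definition ivhfss_compl (R : realType) (U E : Type) (A : set E)
    (F : ivhfss R U A) : ivhfss R U A :=
  fun e h => ivhfe_compl (F e h).

Definition ivhfss_union (R : realType) (U E : Type) (A : set E)
    (F G : ivhfss R U A) : ivhfss R U A :=
  fun e h => ivhfe_union (F e h) (G e h).

Definition ivhfss_inter (R : realType) (U E : Type) (A : set E)
    (F G : ivhfss R U A) : ivhfss R U A :=
  fun e h => ivhfe_inter (F e h) (G e h).

(* Main.v *)
Require Import Defs.
From mathcomp Require Import all_boot all_order all_algebra.
From mathcomp Require Import boolp classical_sets reals.
Local Open Scope classical_set_scope.

(** The map x |-> 1 - x reverses the order, so it exchanges max and min.
    Complementing an interval applies this map to both endpoints and swaps
    them; since max and min of intervals act endpoint by endpoint, the De Morgan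
    laws hold for intervals ([subitv01_compl_max], [subitv01_compl_min]).  They
    pass to hesitant fuzzy elements because union and intersection are images
    of pairs of intervals, and complement is an elementwise image
    ([image_image2_morph]); soft sets are compared value by value. *)

(** An interval is determined by its endpoints. *)
Lemma subitv01_eq (R : realType) (g1 g2 : subitv01 R) :
  itv_lo g1 = itv_lo g2 -> itv_hi g1 = itv_hi g2 -> g1 = g2.
Proof.
case: g1 g2 => [l1 u1 p1] [l2 u2 p2] /= el eu.
by case: l2 / el p2; case: u2 / eu => p2; rewrite (bool_irrelevance p1 p2).
Qed.

(** A hesitant fuzzy element is determined by its set of intervals. *)
Lemma ivhfe_eq (R : realType) (mu1 mu2 : ivhfe R) :
  ivhfe_set mu1 = ivhfe_set mu2 -> mu1 = mu2.
Proof.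
case: mu1 mu2 => [s1 p1] [s2 p2] /= es.
by case: s2 / es p2 => p2; rewrite (Prop_irrelevance p1 p2).
Qed.

Lemma subitv01_compl_max (R : realType) (g1 g2 : subitv01 R) :
  subitv01_compl (subitv01_max g1 g2)
    = subitv01_min (subitv01_compl g1) (subitv01_compl g2).
Proof.
by apply: subitv01_eq; rewrite /= Num.Theory.oppr_max Num.Theory.addr_minr.
Qed.

Lemma subitv01_compl_min (R : realType) (g1 g2 : subitv01 R) :
  subitv01_compl (subitv01_min g1 g2)
    = subitv01_max (subitv01_compl g1) (subitv01_compl g2).
Proof.
by apply: subitv01_eq; rewrite /= Num.Theory.oppr_min Num.Theory.addr_maxr.
Qed.

(** If c turns the operation f into the operation k, then it also turns the
    elementwise extension of f to sets into that of k. *)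
Lemma image_image2_morph (T S : Type) (c : T -> S) (f : T -> T -> T)
    (k : S -> S -> S) (A B : set T) :
  (forall x y, c (f x y) = k (c x) (c y)) ->
  c @` [set f x y | x in A & y in B]
    = [set k x y | x in c @` A & y in c @` B].
Proof.
move=> cf; apply/seteqP; split=> z /=.
  case=> _ [x Ax [y By <-]] <-.
  by exists (c x); [exists x|exists (c y); [exists y|rewrite cf]].
case=> _ [x Ax <-] [_ [y By <-] <-].
by exists (f x y); [exists x => //; exists y|rewrite cf].
Qed.

Lemma ivhfe_compl_union (R : realType) (mu1 mu2 : ivhfe R) :
  ivhfe_compl (ivhfe_union mu1 mu2)
    = ivhfe_inter (ivhfe_compl mu1) (ivhfe_compl mu2).
Proof.
by apply: ivhfe_eq; apply: image_image2_morph; apply: subitv01_compl_max.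
Qed.

Lemma ivhfe_compl_inter (R : realType) (mu1 mu2 : ivhfe R) :
  ivhfe_compl (ivhfe_inter mu1 mu2)
    = ivhfe_union (ivhfe_compl mu1) (ivhfe_compl mu2).
Proof.
by apply: ivhfe_eq; apply: image_image2_morph; apply: subitv01_compl_min.
Qed.

Theorem proposition3p6 (R : realType) (U E : Type) (A : set E)
    (hA : A !=set0) (F G : ivhfss R U A) :
  ivhfss_compl (ivhfss_union F G)
    = ivhfss_inter (ivhfss_compl F) (ivhfss_compl G)
  /\
  ivhfss_compl (ivhfss_inter F G)
    = ivhfss_union (ivhfss_compl F) (ivhfss_compl G).
Proof.
split; apply/funext => e; apply/funext => h.
- exact: ivhfe_compl_union.
- exact: ivhfe_compl_inter.
Qed.
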